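(* Let $G$ be a connected graph with vertex $i$. Then $(G,i)$ allows the nullity pair $(1,2)$ if and only if it is not the case that $(G,i)$ is a yam graph with $G-i$ having at most one component.
   Context: All matrices are real. For a simple graph $G$ on $[n]$, $\mathcal{S}(G)$ is the set of real symmetric $n\times n$ matrices whose off-diagonal $(j,k)$ entry is nonzero iff $\{j,k\}\in E(G)$ (diagonal free). $A(i)$ is $A$ with row and column $i$ deleted (a $0\times 0$ matrix has nullity $0$). $(G,i)$ allows the nullity pair $(k,\ell)$ if some $A\in\mathcal{S}(G)$ has $(\operatorname{null}(A),\operatorname{null}(A(i)))=(k,\ell)$. A generalized star is a tree with exactly one vertex of degree at least $3$ (its center). A yam graph is a connected rooted graph $(G,i)$ such that each component of $G-i$ is a generalized star or a path, and for each component that is a generalized star, $i$ is adjacent only to its center among that component's vertices. *)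

(* Defs.v *)
From HB Require Import structures.
From mathcomp Require Export all_boot all_order all_algebra.
From mathcomp Require Export reals.

Set Implicit Arguments.
Unset Strict Implicit.
Unset Printing Implicit Defensive.

Import GRing.Theory.

Local Open Scope ring_scope.

Record sgraph (n : nat) := SGraph {
  adj :> rel 'I_n;
  adj_sym : symmetric adj;
  adj_irr : irreflexive adj }.

Section Graphs.
Variables (n : nat) (G : sgraph n).
Implicit Types (S : {set 'I_n}) (i c x y : 'I_n).

(* Subgraphs occur only as induced subgraphs G[S]; G - i is G[[set~ i]]. *)
Definition induced S : rel 'I_n :=
  [rel x y | [&& x \in S, y \in S & G x y]].

Definition components S : {set {set 'I_n}} :=
  [set [set y in S | connect (induced S) x y] | x in S].

Definition connected S : Prop :=
  S != set0 /\ {in S &, forall x y, connect (induced S) x y}.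

Definition degree S x : nat := #|[set y in S | G x y]|.

(* [ucycle] also holds for [::] and for [:: x; y] with x, y adjacent, whence
   the bound on the size. *)
Definition acyclic S : Prop :=
  forall p : seq 'I_n, ucycle (induced S) p -> (size p < 3)%N.

Definition is_tree S : Prop := connected S /\ acyclic S.

Definition is_path S : Prop :=
  exists (m : nat) (f : 'I_m -> 'I_n),
    [/\ (0 < m)%N, injective f, S = [set f j | j in 'I_m] &
        forall j k : 'I_m, G (f j) (f k) = (j.+1 == k) || (k.+1 == j)].

Definition high_degree S c : Prop := c \in S /\ (3 <= degree S c)%N.

Definition is_generalized_star S : Prop :=
  is_tree S /\ exists! c, high_degree S c.

Definition is_center S c : Prop :=
  is_generalized_star S /\ high_degree S c.

Definition is_yam i : Prop :=
  connected setT /\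
  forall C, C \in components [set~ i] ->
    (is_generalized_star C \/ is_path C) /\
    (is_generalized_star C -> {in C, forall x, G i x <-> is_center C x}).

End Graphs.

Section NullityPairs.
Variable R : realType.

Definition in_SG n (G : sgraph n) (A : 'M[R]_n) : Prop :=
  A^T = A /\ forall j k : 'I_n, j != k -> (A j k != 0) = G j k.

(* [kermx] is the left kernel, so the transpose gives dim {x | A x = 0}. *)
Definition nullity n (A : 'M[R]_n) : nat := \rank (kermx A^T).

Definition del_rc n (A : 'M[R]_n) (i : 'I_n) : 'M[R]_n.-1 := row' i (col' i A).

Definition allows_nullity_pair n (G : sgraph n) (i : 'I_n) (k l : nat) : Prop :=
  exists A : 'M[R]_n,
    in_SG G A /\ (nullity A, nullity (del_rc A i)) = (k, l).

End NullityPairs.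

(* Main.v *)
Require Import Defs.
From mathcomp Require Import boolp ring lra zify.

Set Implicit Arguments.
Unset Strict Implicit.
Unset Printing Implicit Defensive.

Import Order.TTheory GRing.Theory Num.Theory.

Local Open Scope ring_scope.

(** Write [B = A(i)] and let [b] be the column of [A] at [i] without its diagonal
    entry. The pair [(1, 2)] occurs iff [B] has nullity 2 and some kernel vector of
    [B] is not orthogonal to [b]; as [b] only has a prescribed support, this asks
    for a matrix of nullity 2 with pattern [G - i] and a kernel vector that does
    not vanish at some neighbour of [i].

    If [G - i] is disconnected, take Laplacians on two components and positive
    definite matrices on the others. If [G - i] is connected with a cycle, give a
    suitable negative weight to one edge of the cycle in the Laplacian; the
    all-ones vector stays in the kernel. If [G - i] is a tree, a vertex [c] of
    degree at least 3 other than a neighbour [j] of [i] separates at least three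
    branches; Laplacians on three of them, one containing [j], glue to a matrix of
    nullity 2.

    Conversely, a kernel vector of a path vanishing at an end vertex is zero, so
    the nullity is at most 1. On a generalized star with nullity 2, some nonzero
    kernel vector vanishes at the center; it lives on the legs, and testing other
    kernel vectors against one of its legs shows that they all vanish at the
    center. *)

(** * Kernels, nullity and deletion of a row and column *)

Section LinearAlgebra.
Variables (R : realType) (n : nat).
Implicit Types (M : 'M[R]_n) (x u v : 'I_n -> R).

Definition in_ker M x := forall y, \sum_z M y z * x z = 0.

Lemma in_kerP M (x : 'rV[R]_n) : reflect (in_ker M (x 0)) (x <= kermx M^T)%MS.
Proof.
apply: (iffP sub_kermxP) => [h y|h].
  move/rowP/(_ y): h; rewrite !mxE => h; rewrite -[RHS]h.
  by apply: eq_bigr => z _; rewrite mxE mulrC.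
apply/rowP => y; rewrite !mxE -[RHS](h y).
by apply: eq_bigr => z _; rewrite mxE mulrC.
Qed.

Lemma nullity_eq M k (U : 'M[R]_(k, n)) : row_free U ->
  (forall x : 'rV[R]_n, in_ker M (x 0) <-> (x <= U)%MS) -> nullity M = k.
Proof.
move=> /eqP freeU kerU; rewrite /nullity -[RHS]freeU.
have kU : (kermx M^T <= U)%MS.
  by apply/row_subP => y; apply/kerU/in_kerP; exact: row_sub.
have Uk : (U <= kermx M^T)%MS.
  by apply/row_subP => y; apply/in_kerP/kerU; exact: row_sub.
by apply/eqP; rewrite eqn_leq !mxrankS.
Qed.

Lemma nullity1 M u (z0 : 'I_n) : u z0 != 0 -> in_ker M u ->
  (forall x, in_ker M x -> exists a, forall z, x z = a * u z) -> nullity M = 1%N.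
Proof.
move=> uz0 ku span; apply: (@nullity_eq _ _ (\row_z u z)).
  rewrite /row_free rank_rV eqb1.
  by apply: contra uz0 => /eqP/rowP/(_ z0); rewrite !mxE => ->.
move=> x; split.
  move/span => [a xE]; apply/sub_rVP; exists a; apply/rowP => z.
  by rewrite !mxE xE.
move/sub_rVP => [a ->] y; under eq_bigr => z _ do rewrite !mxE mulrCA.
by rewrite -mulr_sumr ku mulr0.
Qed.

Lemma nullity2 M u v : in_ker M u -> in_ker M v ->
  (forall a b, (forall z, a * u z + b * v z = 0) -> a = 0 /\ b = 0) ->
  (forall x, in_ker M x -> exists a b, forall z, x z = a * u z + b * v z) ->
  nullity M = 2%N.
Proof.
move=> ku kv indep span.
pose U : 'M[R]_(1 + 1, n) := col_mx (\row_z u z) (\row_z v z).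
have mulU (w : 'rV[R]_(1 + 1)) z : (w *m U) 0 z =
    w 0 (lshift 1 0) * u z + w 0 (rshift 1 0) * v z.
  rewrite mxE big_split_ord /= !big_ord1; congr (_ * _ + _ * _).
    by rewrite col_mxEu mxE.
  by rewrite col_mxEd mxE.
apply: (@nullity_eq _ _ U).
  rewrite -kermx_eq0; apply/rowV0P => w /sub_kermxP/rowP wU.
  have [|a0 b0] := indep (w 0 (lshift 1 0)) (w 0 (rshift 1 0)).
    by move=> z; rewrite -mulU wU mxE.
  apply/rowP => k; rewrite mxE; case: (splitP k) => l lk.
    by rewrite -a0; congr (w _ _); apply: val_inj; rewrite /= lk ord1.
  by rewrite -b0; congr (w _ _); apply: val_inj; rewrite /= lk ord1.
move=> x; split.
  move/span => [a [b xE]]; apply/submxP.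
  exists (row_mx a%:M b%:M); apply/rowP => z.
  by rewrite mulU row_mxEl row_mxEr !mxE !eqxx !mulr1n xE.
move/submxP => [w ->] y; under eq_bigr => z _ do rewrite mulU mulrDr !(mulrCA (M y z)).
by rewrite big_split /= -!mulr_sumr ku kv !mulr0 addr0.
Qed.

(** The space where [f] vanishes has codimension at most 1, so it meets a kernel of dimension at
    least 2 nontrivially. *)
Lemma nullity_functional M (f : 'I_n -> R) : (1 < nullity M)%N ->
  exists w, [/\ in_ker M w, exists z, w z != 0 & \sum_z f z * w z = 0].
Proof.
move=> null2; pose K := kermx M^T; pose L := kermx (\col_z f z).
have rL : (n.-1 <= \rank L)%N.
  rewrite mxrank_ker; have := rank_leq_col (\col_z f z); lia.
have rKL : (0 < \rank (K :&: L)%MS)%N.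
  have := mxrank_sum_cap K L; have := rank_leq_row (K + L)%MS.
  have := null2; rewrite /nullity -/K; lia.
pose w := nz_row (K :&: L)%MS.
have wn0 : w != 0 by rewrite nz_row_eq0 -mxrank_eq0 -lt0n.
have : (w <= K :&: L)%MS by exact: nz_row_sub.
rewrite sub_capmx => /andP[/in_kerP wK /sub_kermxP/rowP/(_ 0)].
rewrite !mxE => wL; exists (w 0); split => //.
  apply/existsP; apply: contraNT wn0; rewrite negb_exists => /forallP w0.
  by apply/eqP/rowP => z; rewrite mxE; apply/eqP; move: (w0 z); rewrite negbK.
by rewrite -[RHS]wL; apply: eq_bigr => z _; rewrite mxE mulrC.
Qed.

Lemma nullity_sub M M' : (forall x, in_ker M x -> in_ker M' x) ->
  (nullity M <= nullity M')%N.
Proof.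
move=> sub; apply: mxrankS; apply/row_subP => y.
by apply/in_kerP/sub/in_kerP; exact: row_sub.
Qed.

Lemma inj_solvable M : (forall x, in_ker M x -> forall z, x z = 0) ->
  forall d : 'I_n -> R, exists x : 'I_n -> R, forall y, \sum_z M y z * x z = d y.
Proof.
move=> inj d.
have freeM : row_free M^T.
  rewrite -kermx_eq0; apply/rowV0P => w /in_kerP/inj w0.
  by apply/rowP => z; rewrite w0 mxE.
have fullM : row_full M^T by rewrite row_full_unit -row_free_unit.
have /submxP [w /rowP dE] := submx_full (\row_z d z) fullM.
exists (w 0) => y; have := dE y; rewrite !mxE => ->.
by apply: eq_bigr => z _; rewrite mxE mulrC.
Qed.

(* [A] with row and column [i] replaced by those of the identity matrix: the
   kernel of [A(i)], extended by zero at [i], is the kernel of this matrix. *)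
Definition pin (A : 'M[R]_n) (i : 'I_n) : 'M[R]_n :=
  \matrix_(y, z) if (y == i) || (z == i) then (y == z)%:R else A y z.

Lemma in_ker_pin A i x : in_ker (pin A i) x <->
  x i = 0 /\ forall y, y != i -> \sum_z A y z * x z = 0.
Proof.
have rowi : \sum_z pin A i i z * x z = x i.
  rewrite (bigD1 i) //= mxE !eqxx mul1r big1 ?addr0 // => z zi.
  by rewrite mxE eqxx /= eq_sym (negPf zi) mul0r.
have rowy y : y != i -> x i = 0 ->
    \sum_z pin A i y z * x z = \sum_z A y z * x z.
  move=> yi xi; apply: eq_bigr => z _; rewrite mxE (negPf yi) /=.
  by case: eqVneq => [->|//]; rewrite xi !mulr0.
split=> [k|[xi k] y].
  have xi : x i = 0 by rewrite -rowi k.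
  by split=> // y yi; rewrite -rowy.
by have [->|yi] := eqVneq y i; rewrite ?rowi // rowy ?k.
Qed.

End LinearAlgebra.

(** Right multiplication by [P] inserts a zero coordinate at [i]; it is injective and maps the
    kernel of [A(i)] onto that of [pin A i]. *)
Lemma nullity_del_rc (R : realType) n (A : 'M[R]_n) (i : 'I_n) :
  nullity (del_rc A i) = nullity (pin A i).
Proof.
case: n A i => [|n] A i; first by case: i.
pose P : 'M[R]_(n, n.+1) := row' i 1%:M.
have PE (w : 'rV[R]_n) : (w *m P) 0 i = 0 /\ forall k, (w *m P) 0 (lift i k) = w 0 k.
  split=> [|k]; rewrite mxE.
    by rewrite big1 // => l _; rewrite !mxE eq_sym (negPf (neq_lift i l)) mulr0.
  rewrite (bigD1 k) //= !mxE eqxx mulr1 big1 ?addr0 // => l lk.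
  by rewrite !mxE (inj_eq lift_inj) (negPf lk) mulr0.
have freeP : row_free P.
  rewrite -kermx_eq0; apply/rowV0P => w /sub_kermxP/rowP w0.
  by apply/rowP => k; have [_ <-] := PE w; rewrite w0 !mxE.
have sumE (x : 'rV[R]_n.+1) (w : 'rV[R]_n) y : x 0 i = 0 ->
    (forall k, x 0 (lift i k) = w 0 k) ->
    \sum_z A (lift i y) z * x 0 z = \sum_k del_rc A i y k * w 0 k.
  move=> xi xw; rewrite (bigD1_ord i) //= xi mulr0 add0r.
  by apply: eq_bigr => k _; rewrite xw !mxE.
rewrite /nullity -(mxrankMfree (kermx (del_rc A i)^T) freeP).
apply/eqP; rewrite eqn_leq; apply/andP; split; apply: mxrankS.
  apply/row_subP => y; rewrite row_mul; set w := row y _.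
  have /in_kerP kw : (w <= kermx (del_rc A i)^T)%MS by exact: row_sub.
  have [wi wl] := PE w.
  apply/in_kerP/in_ker_pin; split=> // t; case: (unliftP i t) => [k ->|->]; last by rewrite eqxx.
  by move=> _; rewrite (sumE _ w).
apply/row_subP => y; set x := row y _.
have /in_kerP/in_ker_pin[xi kx] : (x <= kermx (pin A i)^T)%MS by exact: row_sub.
have -> : x = (\row_k x 0 (lift i k)) *m P.
  apply/rowP => t; have [wi wl] := PE (\row_k x 0 (lift i k)).
  case: (unliftP i t) => [k ->|->]; last by rewrite wi xi.
  by rewrite wl [RHS]mxE.
apply: submxMr; apply/in_kerP => k.
rewrite -(sumE x) //; last by move=> l; rewrite [RHS]mxE.
by apply: kx; rewrite eq_sym neq_lift.
Qed.

(** * Symmetric matrices and a criterion for the pair (1, 2) *)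

Lemma sym_pairing (R : realType) n (M : 'M[R]_n) (x u : 'I_n -> R) : M^T = M ->
  \sum_y u y * (\sum_z M y z * x z) = \sum_y x y * (\sum_z M y z * u z).
Proof.
move=> symM; under eq_bigr do rewrite mulr_sumr.
under [RHS]eq_bigr do rewrite mulr_sumr.
rewrite exchange_big /=; apply: eq_bigr => y _; apply: eq_bigr => z _.
have -> : M z y = M y z by rewrite -{1}symM mxE.
by ring.
Qed.

(* The entries of row [i] are chosen so that their pairing with [u] is a sum of
   squares; hence it is not orthogonal to the kernel of [A(i)]. *)
Lemma allows_of_ker_basis (R : realType) n (G : sgraph n) (i j : 'I_n)
    (B : 'M[R]_n) (u v : 'I_n -> R) :
  B^T = B ->
  (forall y z, y != i -> z != i -> y != z -> (B y z != 0) = G y z) ->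
  G i j -> u j != 0 ->
  in_ker (pin B i) u -> in_ker (pin B i) v ->
  (forall a b, (forall z, a * u z + b * v z = 0) -> a = 0 /\ b = 0) ->
  (forall x, in_ker (pin B i) x ->
     exists a b, forall z, x z = a * u z + b * v z) ->
  allows_nullity_pair R G i 1 2.
Proof.
move=> symB patB Gij uj ku kv indep span.
pose b z : R := (G i z)%:R * (if u z == 0 then 1 else u z).
pose A : 'M[R]_n := \matrix_(y, z)
  if y == i then b z else if z == i then b y else B y z.
have bE z : (b z != 0) = G i z.
  rewrite /b mulf_eq0 negb_or pnatr_eq0 eqb0 negbK.
  by case: (eqVneq (u z) 0) => [_|uz]; rewrite ?oner_eq0 ?uz andbT.
have symA : A^T = A.
  apply/matrixP => y z; rewrite !mxE.
  have -> : B z y = B y z by rewrite -{1}symB mxE.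
  by have [yi|_] := eqVneq y i; have [zi|_] := eqVneq z i; rewrite ?yi ?zi.
have pinA : pin A i = pin B i.
  apply/matrixP => y z; rewrite !mxE.
  by have [//|_] := eqVneq y i; have [//|_] := eqVneq z i.
pose s := \sum_z b z * u z; pose t := \sum_z b z * v z.
have rowi x : \sum_z A i z * x z = \sum_z b z * x z.
  by apply: eq_bigr => z _; rewrite mxE eqxx.
have s_gt0 : 0 < s.
  rewrite /s (bigD1 j) //= /b Gij (negPf uj) mul1r.
  apply: ltr_pwDl; first by rewrite -expr2 exprn_even_gt0.
  apply: sumr_ge0 => z _; case: (eqVneq (u z) 0) => [->|_]; first by rewrite mulr0.
  by rewrite -mulrA -expr2 mulr_ge0 ?sqr_ge0.
exists A; split; first split => //.
  move=> y z yz; rewrite mxE; have [->|yi] := eqVneq y i; first exact: bE.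
  have [->|zi] := eqVneq z i; first by rewrite bE adj_sym.
  exact: patB.
rewrite nullity_del_rc pinA (nullity2 ku kv indep span); congr (_, _).
have [ui _] := (in_ker_pin _ _ _).1 ku.
(* Subtracting this multiple of [u] makes [v] orthogonal to row [i]; [w] will span the kernel of
   [A]. *)
pose w z := v z - t / s * u z.
have [z0 wz0] : exists z0, w z0 != 0.
  apply: contrapT => noz; have [|_ /eqP] := indep (- (t / s)) 1; last by rewrite oner_eq0.
  move=> z; rewrite mul1r addrC mulNr; apply/eqP/negPn/negP => h.
  by apply: noz; exists z.
have sw : \sum_z b z * w z = 0.
  under eq_bigr => z _ do rewrite /w mulrBr mulrCA.
  by rewrite sumrB -mulr_sumr -/s -/t divfK ?subrr // gt_eqF.
apply: (@nullity1 _ _ _ w z0) => // [|x kx].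
  move=> y; have [->|yi] := eqVneq y i; first by rewrite rowi.
  under eq_bigr => z _ do rewrite /w mulrBr mulrCA.
  rewrite sumrB -mulr_sumr.
  move: ku kv; rewrite -pinA => /in_ker_pin[_ ku] /in_ker_pin[_ kv].
  by rewrite ku // kv // mulr0 subr0.
(* [A u] is [s] at [i] and zero elsewhere, so pairing [A x = 0] with [u] gives [s * x i = 0]. *)
have xi : x i = 0.
  have := sym_pairing x u symA.
  rewrite big1 => [|y _]; last by rewrite kx mulr0.
  rewrite (bigD1 i) //= [X in _ + X]big1 => [|y yi].
    by rewrite rowi addr0 => /esym/eqP; rewrite mulf_eq0 (gt_eqF s_gt0) orbF => /eqP.
  by move: ku; rewrite -pinA => /in_ker_pin[_ ->] //; rewrite mulr0.
have [|a [c xE]] := span x.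
  by rewrite -pinA; apply/in_ker_pin.
exists c => z; rewrite xE /w.
have : a * s + c * t = 0.
  rewrite -[RHS](kx i) rowi /s /t !mulr_sumr -big_split /=.
  by apply: eq_bigr => k _; rewrite xE; ring.
move/eqP; rewrite addr_eq0 => /eqP aE.
have -> : a = - (c * t) / s by rewrite -aE mulfK // gt_eqF.
by ring.
Qed.

(** * Graph Laplacians with a diagonal perturbation *)

Section Laplacian.
Variables (R : realType) (n : nat) (e : rel 'I_n).
Hypothesis e_sym : symmetric e.
Implicit Types (x f D : 'I_n -> R).

(** The graph Laplacian of [e] applied to [x], at the vertex [y]. *)
Definition lap x y : R := \sum_z (e y z)%:R * (x y - x z).

(** The Laplacian matrix of [e] plus the diagonal matrix [D]. *)
Definition lapmx D : 'M[R]_n :=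
  \matrix_(y, z) ((y == z)%:R * (\sum_t (e y t)%:R + D y) - (e y z)%:R).

Lemma lapmxE D x y : \sum_z lapmx D y z * x z = lap x y + D y * x y.
Proof.
under eq_bigr => z _ do rewrite mxE mulrBl -mulrA.
rewrite sumrB (bigD1 y) //= eqxx mul1r [X in _ + X - _]big1 ?addr0 => [|z zy]; last first.
  by rewrite eq_sym (negPf zy) mul0r.
rewrite /lap; under [in RHS]eq_bigr => z _ do rewrite mulrBr.
by rewrite sumrB -mulr_suml; ring.
Qed.

Lemma lapmx_sym D : (lapmx D)^T = lapmx D.
Proof.
by apply/matrixP => y z; rewrite !mxE e_sym eq_sym; have [->//|_] := eqVneq y z; rewrite !mul0r.
Qed.

Lemma lapmx_offdiag D y z : y != z -> (lapmx D y z != 0) = e y z.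
Proof.
by move=> yz; rewrite mxE (negPf yz) mul0r sub0r oppr_eq0 pnatr_eq0 eqb0 negbK.
Qed.

Lemma lap_pairing f x : \sum_y f y * lap x y = \sum_y x y * lap f y.
Proof.
have lapE g y : lap g y = \sum_z lapmx (fun=> 0) y z * g z by rewrite lapmxE mul0r addr0.
under eq_bigr do rewrite lapE; under [RHS]eq_bigr do rewrite lapE.
exact: sym_pairing (lapmx_sym _).
Qed.

(** Symmetrizing the double sum counts every edge from both ends, which produces the factor 2. *)
Lemma lap_energy x :
  2 * (\sum_y x y * lap x y) = \sum_y \sum_z (e y z)%:R * (x y - x z) ^+ 2.
Proof.
have swap : \sum_y x y * lap x y = \sum_y \sum_z (e y z)%:R * (x z ^+ 2 - x y * x z).
  rewrite exchange_big /=; apply: eq_bigr => y _; rewrite mulr_sumr.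
  by apply: eq_bigr => z _; rewrite e_sym; ring.
rewrite mulr2n mulrDl mul1r {2}swap -big_split /=; apply: eq_bigr => y _.
rewrite mulr_sumr -big_split /=; apply: eq_bigr => z _; ring.
Qed.

(** The energy is a sum of nonnegative terms, so each edge term must vanish. *)
Lemma lap_le0_const x : \sum_y x y * lap x y <= 0 -> forall y z, e y z -> x y = x z.
Proof.
move=> le0 y z yz.
have term_ge0 a b : 0 <= (e a b)%:R * (x a - x b) ^+ 2 by rewrite mulr_ge0 ?sqr_ge0.
have sum0 : \sum_y \sum_z (e y z)%:R * (x y - x z) ^+ 2 = 0.
  apply/eqP; rewrite eq_le -{1}lap_energy sumr_ge0 ?andbT => [|a _].
    by rewrite pmulr_rle0.
  exact: sumr_ge0.
have /eqP := sum0; rewrite psumr_eq0 => [/allP/(_ y)|a _]; last exact: sumr_ge0.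
rewrite mem_index_enum => /(_ isT)/implyP/(_ isT).
rewrite psumr_eq0 // => /allP/(_ z); rewrite mem_index_enum => /(_ isT)/implyP/(_ isT).
by rewrite yz mul1r sqrf_eq0 subr_eq0 => /eqP.
Qed.

Lemma lap_connect_const x : (forall y z, e y z -> x y = x z) ->
  forall y z, connect e y z -> x y = x z.
Proof.
move=> cst y z /connectP[p ep ->].
by elim: p y ep => //= a p IHp y /andP[/cst -> /IHp].
Qed.

(** Pairing the equation with [x] shows that the energy is minus the sum of the [D y * x y ^+ 2],
    hence nonpositive. So [x] is constant along edges, its Laplacian vanishes, and the equation
    leaves [D y * x y = 0]. *)
Lemma lapmx_ker D x : (forall y, 0 <= D y) ->
  (forall y, lap x y + D y * x y = 0) ->
  (forall y z, connect e y z -> x y = x z) /\ forall y, D y * x y = 0.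
Proof.
move=> D_ge0 ker.
have cst : forall y z, e y z -> x y = x z.
  apply: lap_le0_const; apply: sumr_le0 => y _.
  have /eqP := ker y; rewrite addr_eq0 => /eqP ->.
  by rewrite mulrN oppr_le0 mulrCA -expr2 mulr_ge0 ?sqr_ge0.
split=> [|y]; first exact: lap_connect_const.
rewrite -[RHS](ker y) [X in X + _]big1 ?add0r // => z _.
by case yz: (e y z); rewrite ?mul0r // (cst _ _ yz) subrr mulr0.
Qed.

Lemma lap_const x : (forall y z, e y z -> x y = x z) -> forall y, lap x y = 0.
Proof.
move=> cst y; apply: big1 => z _.
by case yz: (e y z); rewrite ?mul0r // (cst _ _ yz) subrr mulr0.
Qed.

Lemma connect_indicator a y z : e y z ->
  (connect e a y)%:R = (connect e a z)%:R :> R.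
Proof.
move=> yz; congr (_%:R); congr nat_of_bool; apply/idP/idP => h.
  exact: connect_trans h (connect1 yz).
by apply: connect_trans h (connect1 _); rewrite e_sym.
Qed.

End Laplacian.

(** * Walks in induced subgraphs *)

Section InducedGraphs.
Variables (n : nat) (G : sgraph n).
Implicit Types (S : {set 'I_n}) (c x y z : 'I_n).

Lemma induced_sym S : symmetric (induced G S).
Proof. by move=> x y; rewrite /induced /= adj_sym andbCA. Qed.

Lemma connect_induced_sym S : connect_sym (induced G S).
Proof. exact/sym_connect_sym/induced_sym. Qed.

Lemma connect_induced_in S x y : x \in S -> connect (induced G S) x y -> y \in S.
Proof.
move=> xS /connectP[p + ->]; elim: p x xS => //= a p IHp x _.
by case/andP => /and3P[_ aS _]; apply: IHp.
Qed.

(** A walk without repetitions never returns to [c], so after its first edge it stays in the branch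
    of [a] at [c]. *)
Lemma first_step S c x : connect (induced G S) c x -> x != c ->
  exists a q, [/\ induced G S c a, path (induced G (S :\ c)) a q,
                  uniq [:: c, a & q] & x = last a q].
Proof.
move=> /connectP[p0 /shortenP[p ep up _] ->].
case: p ep up => [|a q] /=; first by rewrite eqxx.
move=> /andP[ca aq] up _; exists a, q; split=> //.
move: up => /andP[cNaq _]; elim: q a {ca} aq cNaq => //= b q IHq a.
case/andP=> /and3P[aS bS ab] bq; rewrite !inE !negb_or => /and3P[ca cb cq].
rewrite /induced /= !inE aS bS ab ![_ == c]eq_sym ca cb /=; apply: IHq => //.
by rewrite inE negb_or cb.
Qed.

End InducedGraphs.

(** * Matrices realising the pair (1, 2) *)

Section Constructions.
Variables (R : realType) (n : nat) (G : sgraph n) (i j : 'I_n).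
Hypothesis Gij : G i j.
Local Notation S := [set~ i].

Lemma root_nbr : j \in S.
Proof. by rewrite !inE; apply: contraTneq Gij => ->; rewrite adj_irr. Qed.

(** The pinned matrix imposes no Laplacian equation at [i], but there it holds trivially, because
    [i] is isolated in [e] and [x i = 0]. *)
Lemma in_ker_pin_lapmx (e : rel 'I_n) (D x : 'I_n -> R) :
  (forall z, e i z = false) -> in_ker (pin (lapmx e D) i) x <->
  x i = 0 /\ forall y, lap e x y + D y * x y = 0.
Proof.
move=> ei; split=> [/in_ker_pin[xi kx]|[xi kx]].
  split=> // y; have [->|yi] := eqVneq y i; last by rewrite -lapmxE kx.
  by rewrite xi mulr0 addr0; apply: big1 => z _; rewrite ei mul0r.
by apply/in_ker_pin; split=> // y _; rewrite lapmxE.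
Qed.

Lemma allows_disconnected a : a \in S -> ~~ connect (induced G S) j a ->
  allows_nullity_pair R G i 1 2.
Proof.
move=> aS ja; set e := induced G S in ja.
have e_sym : symmetric e := @induced_sym n G S.
have ei z : e i z = false by rewrite /e /induced /= !inE eqxx.
(* [D] is 1 off the components of [j] and [a], which makes the matrix definite there; [h b] is the
   indicator of the component of [b]. *)
pose D y : R := (~~ connect e j y && ~~ connect e a y)%:R.
pose h b y : R := (connect e b y)%:R.
have hi b : b \in S -> h b i = 0.
  move=> bS; rewrite /h; case bi: connect => //.
  by have := connect_induced_in bS bi; rewrite !inE eqxx.
have disj y : connect e j y -> connect e a y -> False.
  rewrite [connect e a y]connect_induced_sym => jy ya.
  by move: ja; rewrite (connect_trans jy ya).
have kh b : b \in S -> (forall y, D y * h b y = 0) -> in_ker (pin (lapmx e D) i) (h b).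
  move=> bS Dh; apply/in_ker_pin_lapmx => //; split; first exact: hi.
  move=> y; rewrite Dh addr0; apply: lap_const => y' z'.
  exact: connect_indicator.
apply: (@allows_of_ker_basis _ _ _ _ j (lapmx e D) (h j) (h a)) => //.
- exact: lapmx_sym.
- by move=> y z yi zi yz; rewrite lapmx_offdiag // /e /induced /= !inE yi zi.
- by rewrite /h connect0 oner_eq0.
- by apply: kh root_nbr _ => y; rewrite /D /h; case: connect => /=; rewrite ?mul0r ?mulr0.
- by apply: kh => // y; rewrite /D /h andbC; case: connect => /=; rewrite ?mul0r ?mulr0.
- move=> b c bc.
  have := bc j; have := bc a; rewrite /h connect0 (negPf ja) connect0.
  by rewrite connect_induced_sym (negPf ja) /= => *; split; lra.
move=> x /in_ker_pin_lapmx[] // xi kx.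
have [//|//|cst Dx] := @lapmx_ker _ _ e e_sym D x.
exists (x j), (x a) => z; rewrite /h; have := Dx z; rewrite /D.
case jz: (connect e j z); case az: (connect e a z) => /=.
- by case: (disj _ jz az).
- by rewrite (cst _ _ jz) mulr1 mulr0 addr0.
- by rewrite (cst _ _ az) mulr1 mulr0 add0r.
- by rewrite mul1r => ->; rewrite !mulr0 addr0.
Qed.

(* If [L] is the Laplacian of [G[S] - uv] and [L y = d] for [d := e_u - e_v], then
   [L - d d^T / (y_u - y_v)] has pattern [G[S]] and its kernel is spanned by [y]
   and the all-ones vector. *)
Lemma allows_nonbridge u v : connected G S -> induced G S u v ->
  connect [rel y z | induced G S y z && ~~ ((y == u) && (z == v) || (y == v) && (z == u))] u v ->
  allows_nullity_pair R G i 1 2.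
Proof.
move=> [_]; set e := induced G S => conS uv; set e' := (X in connect X) => uv'.
have e_sym : symmetric e := @induced_sym n G S.
have e'_sym : symmetric e'.
  move=> y z; rewrite /e' /= e_sym; congr (_ && ~~ _).
  by rewrite orbC; congr (_ || _); rewrite andbC.
have e'i z : e' i z = false by rewrite /e' /e /induced /= !inE eqxx.
(* Any use of the edge [uv] can be replaced by the detour [uv']. *)
have conS' y z : y \in S -> z \in S -> connect e' y z.
  move=> yS zS; apply: connect_sub (conS _ _ yS zS) => a b ab.
  case ab' : (e' a b); first exact: connect1.
  move: ab'; rewrite /e' /= ab /= => /negbFE /orP[] /andP[/eqP-> /eqP->] //.
  by rewrite (sym_connect_sym e'_sym).
have /and3P[uS vS Guv] := uv.
have u_v : u != v by apply: contraTneq Guv => ->; rewrite adj_irr.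
have v_u : v != u by rewrite eq_sym.
have ui : u != i by move: uS; rewrite !inE.
have vi : v != i by move: vS; rewrite !inE.
pose d y : R := (y == u)%:R - (y == v)%:R.
have du : d u = 1 by rewrite /d eqxx (negPf u_v) subr0.
have dv : d v = -1 by rewrite /d eqxx eq_sym (negPf u_v) sub0r.
have [y [yi yv yL]] : exists y, [/\ y i = 0, y v = 0 & forall z, lap e' y z = d z].
  (* Adding 1 on the diagonal at [v] and [i] makes the Laplacian injective: a kernel vector is
     constant on [S] and vanishes at [v] and at [i]. *)
  pose D z : R := ((z == v) || (z == i))%:R.
  have [|y yE] := @inj_solvable _ _ (lapmx e' D) _ d.
    move=> x kx z.
    have [//|t|cst Dx] := @lapmx_ker _ _ e' e'_sym D x; first by rewrite -lapmxE.
    have [->|zi] := eqVneq z i; first by have := Dx i; rewrite /D eqxx orbT mul1r.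
    rewrite (cst _ v); first by have := Dx v; rewrite /D eqxx mul1r.
    by apply: conS' => //; rewrite !inE.
  have {}yE z : lap e' y z + D z * y z = d z by rewrite -lapmxE.
  have yi : y i = 0.
    have := yE i; rewrite /lap big1 => [|z _]; last by rewrite e'i mul0r.
    rewrite /D eqxx orbT mul1r add0r => ->.
    by rewrite /d ![i == _]eq_sym (negPf ui) (negPf vi) subr0.
  have yv : y v = 0.
    (* Pairing with the indicator of [S] removes the Laplacian and also [d], whose sum over [S] is
       0. What remains is [y v = 0], so the added diagonal term vanishes on [y]. *)
    pose one z : R := (z != i)%:R.
    have : \sum_z one z * (lap e' y z + D z * y z) = \sum_z one z * d z.
      by apply: eq_bigr => z _; rewrite yE.
    under eq_bigr do rewrite mulrDr.
    rewrite big_split /= lap_pairing // [X in X + _]big1 => [|z _]; last first.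
      rewrite lap_const ?mulr0 // => a b; rewrite /e' /e /induced /= => /andP[/and3P[]].
      by rewrite !inE /one => -> ->.
    rewrite add0r (bigD1 v) //= [X in _ + X]big1 => [|z zv]; last first.
      rewrite /D (negPf zv) /=; case: eqVneq => [->|_]; first by rewrite yi !mulr0.
      by rewrite mul0r mulr0.
    rewrite /D /one vi eqxx !mul1r addr0 => ->.
    rewrite (bigD1 u) //= (bigD1 v v_u) /= [X in _ + (_ + X)]big1 => [|z /andP[zu zv]].
      by rewrite ui vi du dv !mul1r addr0 subrr.
    by rewrite /d (negPf zu) (negPf zv) subr0 mulr0.
  exists y; split=> // z; rewrite -yE /D.
  have [->|_] := eqVneq z v; first by rewrite yv mulr0 addr0.
  by have [->|_] := eqVneq z i; rewrite ?yi ?mulr0 ?mul0r addr0.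
have sum_d x : \sum_z d z * x z = x u - x v.
  under eq_bigr do rewrite /d mulrBl.
  rewrite sumrB (bigD1 u) //= eqxx mul1r [X in _ + X - _]big1 => [|z zu].
    rewrite addr0 (bigD1 v) //= eqxx mul1r [X in _ - (_ + X)]big1 ?addr0 // => z zv.
    by rewrite (negPf zv) mul0r.
  by rewrite (negPf zu) mul0r.
(* If [y u] were 0, the energy of [y], which is [y u - y v], would vanish; [y] would be constant
   along edges, against [lap e' y u = 1]. *)
have yu : y u != 0.
  apply/eqP => yu0.
  have cst : forall a b, e' a b -> y a = y b.
    apply: lap_le0_const => //.
    under eq_bigr do rewrite yL mulrC.
    by rewrite sum_d yu0 yv subrr.
  have := yL u; rewrite lap_const // du => /esym/eqP; by rewrite oner_eq0.
pose B : 'M[R]_n := \matrix_(a, b) (lapmx e' (fun=> 0) a b - (y u)^-1 * d a * d b).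
have BE x z : \sum_b B z b * x b = lap e' x z - (y u)^-1 * (x u - x v) * d z.
  under eq_bigr => b _ do rewrite mxE mulrBl -[_ * d b * x b]mulrA.
  by rewrite sumrB lapmxE mul0r addr0 -mulr_sumr sum_d mulrAC.
pose one z : R := (z != i)%:R.
have lap1 z : lap e' one z = 0.
  apply: lap_const => a b; rewrite /e' /e /induced /= => /andP[/and3P[]].
  by rewrite !inE /one => -> ->.
apply: (@allows_of_ker_basis _ _ _ _ j B one y) => //.
- apply/matrixP => a b; rewrite mxE [in LHS]mxE [RHS]mxE.
  have -> : lapmx e' (fun=> 0) b a = lapmx e' (fun=> 0) a b :> R.
    by rewrite -{1}(lapmx_sym e'_sym) mxE.
  by congr (_ - _); rewrite mulrAC.
- move=> a b ai bi ab; rewrite mxE.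
  have eab : e a b = G a b by rewrite /e /induced /= !inE ai bi.
  have := @lapmx_offdiag R n e' (fun=> 0) a b ab.
  have -> : e' a b = G a b && ~~ ((a == u) && (b == v) || (a == v) && (b == u)).
    by rewrite -eab.
  have d0 z : z != u -> z != v -> d z = 0.
    by move=> zu zv; rewrite /d (negPf zu) (negPf zv) subr0.
  have inv0 : (y u)^-1 != 0 by rewrite invr_eq0.
  (* The rank-one term restores the edge [uv] with entry [(y u)^-1] and has no other nonzero
     off-diagonal entries. *)
  case: (boolP ((a == u) && (b == v) || (a == v) && (b == u))) => [ends|nends].
    rewrite andbF => /negbFE/eqP ->; rewrite sub0r oppr_eq0.
    case/orP: ends => /andP[/eqP-> /eqP->]; rewrite du dv.
      by rewrite mulr1 mulrN1 oppr_eq0 inv0 Guv.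
    by rewrite mulr1 mulrN1 oppr_eq0 inv0 adj_sym Guv.
  rewrite andbT => <-; congr (_ != _); rewrite (_ : _ * d a * d b = 0) ?subr0 //.
  move: nends; have [a_u|au] := eqVneq a u.
    rewrite a_u (negPf u_v) orbF => bv.
    by rewrite [d b]d0 ?mulr0 // eq_sym -a_u.
  have [a_v|av] /= := eqVneq a v; last by rewrite [d a]d0 // mulr0 mul0r.
  by move=> bu; rewrite [d b]d0 ?mulr0 // eq_sym -a_v.
- by have := root_nbr; rewrite !inE /one => ->; rewrite oner_eq0.
- apply/in_ker_pin; split=> [|z _]; first by rewrite /one eqxx.
  by rewrite BE lap1 /one ui vi subrr mulr0 mul0r subr0.
- apply/in_ker_pin; split=> // z _.
  by rewrite BE yL yv subr0 mulVf // mul1r subrr.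
- move=> a b ab; have := ab v; rewrite /one vi yv mulr0 addr0 mulr1 => a0.
  split=> //; have /eqP := ab u; rewrite a0 mul0r add0r mulf_eq0 (negPf yu) orbF.
  by move/eqP.
move=> x /in_ker_pin[xi kx].
(* The Laplacian of [x] is [s * d], which is also that of [s * y]; so the difference [f] is constant
   on [S], with value [x v] because [y v = 0]. *)
pose s := (y u)^-1 * (x u - x v); pose f z := x z - s * y z.
have fL z : lap e' f z + 0 * f z = 0.
  have -> : lap e' f z = lap e' x z - s * lap e' y z.
    rewrite /lap mulr_sumr -sumrB; apply: eq_bigr => t _; rewrite /f; ring.
  rewrite mul0r addr0 yL; have [->|zi] := eqVneq z i; last by rewrite -BE kx.
  rewrite /lap big1 => [|t _]; last by rewrite e'i mul0r.
  by rewrite /d ![i == _]eq_sym (negPf ui) (negPf vi) subr0 mulr0 subr0.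
have [||cst _] := @lapmx_ker _ _ e' e'_sym (fun=> 0) f; [by [] | exact: fL |].
exists (x v), s => z; rewrite /one; have [->|zi] := eqVneq z i.
  by rewrite xi yi !mulr0 addr0.
have := cst z v; rewrite conS' ?inE // => /(_ isT); rewrite /f yv mulr0 mulr1; lra.
Qed.

End Constructions.

(** Under this condition each branch at [c] contains exactly one neighbour of [c] and can be named
    by it. *)
Definition separates n (G : sgraph n) (S : {set 'I_n}) (c : 'I_n) : Prop :=
  forall a b, induced G S c a -> induced G S c b -> a != b ->
    ~~ connect (induced G (S :\ c)) a b.

(* Laplacian kernels on three branches at [c], one of them containing [j], and
   positive definite blocks on the remaining branches: the kernel of the whole
   matrix consists of the vectors that are constant on each of the three
   branches, with constants summing to zero. *)
Lemma allows_branching (R : realType) n (G : sgraph n) (i j c : 'I_n)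
    (S := [set~ i]) :
  G i j -> connected G S -> high_degree G S c -> separates G S c -> j != c ->
  allows_nullity_pair R G i 1 2.
Proof.
move=> Gij [_ conS] [cS deg3] sepc jc.
have jS : j \in S := root_nbr Gij.
have ci : c != i by move: cS; rewrite !inE.
set e := induced G (S :\ c) in sepc *.
have e_sym : symmetric e := @induced_sym n G (S :\ c).
have eE y z : e y z = [&& y != c, y != i, z != c, z != i & G y z].
  by rewrite /e /induced /= !inE -!andbA.
have ei z : e i z = false by rewrite eE eqxx andbF.
have ec z : e c z = false by rewrite eE eqxx.
have nbrE a : induced G S c a = (a != i) && G c a.
  by rewrite /induced /= !inE ci.
(* [a1] is the neighbour of [c] whose branch contains [j]. *)
have [a1 [q [ca1 a1q _ jE]]] := first_step (conS _ _ cS jS) jc.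
have a1j : connect e a1 j by apply/connectP; exists q.
pose N := [set a in S | G c a].
have NE a : (a \in N) = induced G S c a by rewrite /induced /= !inE ci.
have [a2 [a3 [ca2 ca3 a12 a13 a23]]] : exists a2 a3,
    [/\ induced G S c a2, induced G S c a3, a1 != a2, a1 != a3 & a2 != a3].
  have : (1 < #|N :\ a1|)%N.
    by move: deg3; rewrite /degree -/N (cardsD1 a1 N) NE ca1.
  case/card_gt1P => a2 [a3 []]; rewrite !in_setD1 !NE => /andP[a21 h2] /andP[a31 h3] a23.
  by exists a2, a3; split=> //; rewrite eq_sym.
pose h a y : R := (connect e a y)%:R.
pose D y : R := [&& ~~ connect e a1 y, ~~ connect e a2 y & ~~ connect e a3 y]%:R.
have nbr_in a : induced G S c a -> a \in S :\ c.
  rewrite nbrE !inE => /andP[-> Gca]; rewrite andbT.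
  by apply: contraTneq Gca => ->; rewrite adj_irr.
have disj a b y : induced G S c a -> induced G S c b -> a != b ->
    connect e a y -> connect e b y = false.
  move=> ca cb ab ay; apply/negP; rewrite connect_induced_sym => yb.
  by move: (sepc _ _ ca cb ab); rewrite (connect_trans ay yb).
have h_out a y : induced G S c a -> y \notin S :\ c -> h a y = 0.
  move=> ca; rewrite /h; case ay: connect => //.
  by rewrite (connect_induced_in (nbr_in _ ca) ay).
have hi a : induced G S c a -> h a i = 0.
  by move=> ca; rewrite h_out // !inE eqxx andbF.
have hc a : induced G S c a -> h a c = 0.
  by move=> ca; rewrite h_out // !inE eqxx.
have lap_h a z : lap e (h a) z = 0.
  by apply: lap_const => y y'; exact: connect_indicator.
have hself a : h a a = 1 by rewrite /h connect0.
have hother a b : induced G S c a -> induced G S c b -> a != b -> h a b = 0.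
  by move=> ca cb ab; rewrite /h (negPf (sepc _ _ ca cb ab)).
have Dh a y : a \in [:: a1; a2; a3] -> D y * h a y = 0.
  rewrite !inE /D /h => /or3P[] /eqP->;
  case: (connect e a1 y); case: (connect e a2 y); case: (connect e a3 y);
  by rewrite /= ?mul0r ?mulr0.
(* Of the branch at [a], the row of [c] sees only the vertex [a]. *)
have sum_h a (g : 'I_n -> R) : induced G S c a ->
    \sum_z (G c z)%:R * h a z * g z = g a.
  move=> ca; rewrite (bigD1 a) //= hself.
  have := ca; rewrite nbrE => /andP[_ ->]; rewrite !mul1r big1 ?addr0 // => z za.
  have [->|zi] := eqVneq z i; first by rewrite hi // mulr0 mul0r.
  case Gcz: (G c z); last by rewrite !mul0r.
  by rewrite hother ?mulr0 ?mul0r // 1?eq_sym // nbrE zi.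
(* The edges at [c], absent from [e], get the entry 1. *)
pose B : 'M[R]_n := \matrix_(y, z)
  (lapmx e D y z + (G y z && ((y == c) || (z == c)))%:R).
have Brow x y : \sum_z B y z * x z =
    lap e x y + D y * x y + \sum_z (G y z && ((y == c) || (z == c)))%:R * x z.
  by rewrite -lapmxE -big_split /=; apply: eq_bigr => z _; rewrite mxE mulrDl.
have Bc x : \sum_z B c z * x z = D c * x c + \sum_z (G c z)%:R * x z.
  rewrite Brow eqxx /= [lap _ _ _]big1 => [|z _]; last by rewrite ec mul0r.
  by rewrite add0r; congr (_ + _); apply: eq_bigr => z _; rewrite andbT.
have By x y : y != c ->
    \sum_z B y z * x z = lap e x y + D y * x y + (G c y)%:R * x c.
  move=> yc; rewrite Brow (bigD1 c) //= eqxx orbT andbT adj_sym big1 ?addr0 // => z zc.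
  by rewrite (negPf yc) (negPf zc) andbF mul0r.
pose u z := h a1 z - h a2 z; pose v z := h a1 z - h a3 z.
have kdiff a b : a \in [:: a1; a2; a3] -> b \in [:: a1; a2; a3] ->
    induced G S c a -> induced G S c b ->
    in_ker (pin B i) (fun z => h a z - h b z).
  move=> a3s b3s ca cb; apply/in_ker_pin; split=> [|y _]; first by rewrite !hi ?subrr.
  have [->|yc] := eqVneq y c.
    rewrite Bc !hc // subrr mulr0 add0r.
    under eq_bigr do rewrite mulrBr -[_ * h a _]mulr1 -[_ * h b _]mulr1.
    by rewrite sumrB (sum_h a (fun=> 1)) // (sum_h b (fun=> 1)) // subrr.
  rewrite By // !hc // subrr mulr0 addr0 mulrBr !Dh // subrr addr0.
  by apply: lap_const => y1 y2 y12; congr (_ - _); exact: connect_indicator.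
apply: (@allows_of_ker_basis _ _ _ _ j B u v) => //.
- apply/matrixP => y z; rewrite !mxE e_sym adj_sym orbC [z == y]eq_sym.
  by congr (_ - _ + _); have [->//|_] := eqVneq y z; rewrite !mul0r.
- move=> y z yi zi yz; rewrite mxE.
  have := @lapmx_offdiag R n e D y z yz; rewrite eE yi zi /=.
  case: (boolP ((y == c) || (z == c))) => yzc.
    have -> : [&& y != c, z != c & G y z] = false.
      by case/orP: yzc => /eqP->; rewrite eqxx ?andbF.
    by move/negbFE/eqP=> ->; rewrite add0r andbT pnatr_eq0 eqb0 negbK.
  by move: yzc; rewrite negb_or andbF addr0 => /andP[-> ->].
- rewrite /u /h a1j (disj a1 a2 j) // subr0 oner_eq0 //.
- by apply: kdiff; rewrite ?inE ?eqxx ?orbT.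
- by apply: kdiff; rewrite ?inE ?eqxx ?orbT.
- move=> a b ab; have := ab a2; have := ab a3; rewrite /u /v !hself !hother //; last 1 first.
  + by rewrite eq_sym.
  by move=> *; split; lra.
move=> x /in_ker_pin[xi kx].
have ky y : y != c -> y != i -> lap e x y + D y * x y + (G c y)%:R * x c = 0.
  by move=> yc yi; rewrite -By // kx.
(* Pairing the rows with [h a2] kills the Laplacian and [D]; the single edge from [c] into that
   branch leaves [x c]. *)
have xc : x c = 0.
  have : \sum_y h a2 y * (lap e x y + D y * x y + (G c y)%:R * x c) = 0.
    apply: big1 => y _; have [->|yc] := eqVneq y c; first by rewrite hc // mul0r.
    have [->|yi] := eqVneq y i; first by rewrite hi // mul0r.
    by rewrite ky // mulr0.
  under eq_bigr do rewrite !mulrDr.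
  rewrite !big_split /= lap_pairing // big1 => [|y _]; last by rewrite lap_h mulr0.
  rewrite big1 => [|y _]; last by rewrite mulrCA mulrA Dh ?mul0r // !inE eqxx orbT.
  rewrite !add0r; under eq_bigr do rewrite mulrA [h _ _ * _]mulrC.
  by rewrite (sum_h a2 (fun=> x c)).
have [//|y|cst Dx] := @lapmx_ker _ _ e e_sym D x.
  have [->|yc] := eqVneq y c.
    by rewrite xc mulr0 addr0; apply: big1 => z _; rewrite ec mul0r.
  have [->|yi] := eqVneq y i.
    by rewrite xi mulr0 addr0; apply: big1 => z _; rewrite ei mul0r.
  by have := ky _ yc yi; rewrite xc mulr0 addr0.
have xE z : x z = x a1 * h a1 z + x a2 * h a2 z + x a3 * h a3 z.
  have := Dx z; rewrite /D /h.
  case: (boolP (connect e a1 z)) => [z1|_].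
    by rewrite (disj a1 a2 z) // (disj a1 a3 z) // (cst _ _ z1) !mulr0 mulr1 !addr0.
  case: (boolP (connect e a2 z)) => [z2|_].
    by rewrite (disj a2 a3 z) // (cst _ _ z2) !mulr0 mulr1 addr0 add0r.
  case: (boolP (connect e a3 z)) => [z3|_].
    by rewrite (cst _ _ z3) !mulr0 mulr1 !add0r.
  by rewrite mul1r => ->; rewrite !mulr0 !addr0.
have sum0 : x a1 + x a2 + x a3 = 0.
  have : \sum_z B c z * x z = 0 by apply: kx.
  rewrite Bc xc mulr0 add0r => <-.
  rewrite -(sum_h a1 (fun=> x a1)) // -(sum_h a2 (fun=> x a2)) // -(sum_h a3 (fun=> x a3)) //.
  rewrite -!big_split /=; apply: eq_bigr => z _; rewrite [in RHS]xE; ring.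
exists (- x a2), (- x a3) => z; rewrite xE /u /v.
have -> : x a1 = - x a2 - x a3 by lra.
by ring.
Qed.

(** * Trees, cycles and paths *)

Section Trees.
Variables (n : nat) (G : sgraph n) (S : {set 'I_n}).
Local Notation e := (induced G S).

(** A path from [a] to [b] avoiding [c] would close up through [c] to a cycle. *)
Lemma acyclic_separates c : acyclic G S -> separates G S c.
Proof.
move=> acyc a b ca cb ab; apply/negP => /connectP[p0 /shortenP[p ep up _] bE].
have inSc x q : path (induced G (S :\ c)) x q -> path e x q.
  apply: sub_path => y z /and3P[]; rewrite !inE => /andP[_ yS] /andP[_ zS] yz.
  by rewrite /induced /= yS zS.
have cN q x : x != c -> path (induced G (S :\ c)) x q -> c \notin q.
  elim: q x => //= y q IHq x _ /andP[/and3P[_]]; rewrite !inE => /andP[yc _] _ yq.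
  by rewrite negb_or eq_sym yc (IHq y).
have ac : a != c by apply: contraTneq ca => ->; rewrite /induced /= adj_irr !andbF.
have /acyc : ucycle e [:: c, a & p].
  rewrite /ucycle /= rcons_path ca inSc //= -bE induced_sym cb /=.
  by rewrite inE negb_or eq_sym ac (cN _ a).
by case: p ep up bE => //= _ _ ba; rewrite ba eqxx in ab.
Qed.

(** Going round a cycle the other way joins the ends of one of its edges without using that edge. *)
Lemma not_acyclic_nonbridge : ~ acyclic G S -> exists u v, e u v /\
  connect [rel y z | e y z && ~~ ((y == u) && (z == v) || (y == v) && (z == u))] u v.
Proof.
move/existsNP => [p /not_implyP[+ /negP]]; rewrite -leqNgt.
case: p => [|u [|v [|w q]]] // cyc _; exists u, v.
set e' := (X in connect X _ _).
have e'_sym : symmetric e'.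
  move=> y z; rewrite /e' /= (induced_sym G S y z); congr (_ && ~~ _).
  by rewrite orbC; congr (_ || _); rewrite andbC.
move: cyc => /andP[/=]; rewrite rcons_path => /and4P[uv vw wq lu].
rewrite !inE !negb_or => /and3P[/and3P[u_v uw uq] /andP[v_w vq] _].
split=> //; rewrite (sym_connect_sym e'_sym).
apply: (@connect_trans _ _ (last w q)); last first.
  apply: connect1; rewrite /e' /= lu eqxx andbT /=.
  have l_wq : last w q \in w :: q by exact: mem_last.
  have lv : last w q != v.
    by apply: contraTneq l_wq => ->; rewrite inE negb_or v_w.
  by rewrite (negPf lv) eq_sym (negPf u_v) /= andbF.
apply/connectP; exists (w :: q) => //.
(* All vertices of this arc differ from [u], so its edges survive in [e']. *)
apply: (@sub_in_path _ (predC1 u) e e').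
- by move=> y z; rewrite /e' !inE => /negPf yu /negPf zu /= ->; rewrite yu zu andbF.
- rewrite /= ![_ == u]eq_sym u_v uw /=.
  by apply/allP => y yq; apply: contraNneq uq => <-.
- by rewrite /= vw.
Qed.

(** A longest simple path in [S] works: a neighbour outside it would extend it at an end or give an
    inner vertex degree 3, so by connectedness it covers [S]; a chord would close a cycle. *)
Lemma acyclic_deg2_is_path : connected G S -> acyclic G S ->
  (forall x, x \in S -> (degree G S x <= 2)%N) -> is_path G S.
Proof.
move=> [/set0Pn[x0 x0S] conS] acyc deg2.
pose P k := [exists t : k.-tuple 'I_n, [&& sorted e t, uniq t & all [in S] t]].
have P1 : exists k, P k.
  by exists 1%N; apply/existsP; exists [tuple x0]; rewrite /= x0S.
have Pn k : P k -> (k <= n)%N.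
  case/existsP => t /and3P[_ ut _].
  by rewrite -(size_tuple t) -(card_uniqP ut) -[X in (_ <= X)%N](card_ord n) max_card.
case: (ex_maxnP P1 Pn) => m /existsP[t /and3P[]].
have := size_tuple t; move: (tval t) => {t} s sz s_sorted s_uniq /allP sS maxm.
have m_gt0 : (0 < m)%N.
  by apply: maxm; apply/existsP; exists [tuple x0]; rewrite /= x0S.
have longer (s' : seq 'I_n) : sorted e s' -> uniq s' -> all [in S] s' -> (size s' <= m)%N.
  by move=> h1 h2 h3; apply: maxm; apply/existsP; exists (in_tuple s'); apply/and3P.
have closed_s a b : a \in s -> e a b -> b \in s.
  move=> as_ ab; apply: contraT => bs.
  have /and3P[aS bS Gab] := ab.
  have sall : all [in S] s by apply/allP.
  have ks : (index a s < m)%N by rewrite -sz index_mem.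
  have aE : nth x0 s (index a s) = a by rewrite nth_index.
  move: (index a s) ks aE => k ks aE.
  have [k0|k_gt0] := posnP k.
    have /longer : sorted e (b :: s).
      rewrite k0 in aE; case: s s_sorted aE {sz sS s_uniq longer as_ bs sall} => //= y s' -> ->.
      by rewrite induced_sym ab.
    by rewrite /= bs s_uniq bS sall sz ltnn => /(_ isT isT).
  have [km|km] := eqVneq k.+1 m.
    have /longer : sorted e (rcons s b).
      case: s s_sorted aE sz {sS s_uniq longer as_ bs sall} => //= y s' ys' aE sz.
      rewrite rcons_path ys' /= (last_nth x0) (_ : size s' = k) ?aE //.
      by move: sz km; lia.
    by rewrite rcons_uniq bs s_uniq all_rcons bS sall size_rcons sz ltnn => /(_ isT isT).
  have /sortedP := s_sorted => /(_ x0) srt.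
  have k1m : (k.+1 < size s)%N by rewrite sz ltn_neqAle km.
  have /and3P[_ _ +] := srt k k1m; rewrite aE => an.
  have := srt k.-1; rewrite prednK // sz => /(_ ks); rewrite aE => /and3P[pS _ pa].
  have nS : nth x0 s k.+1 \in S by apply: sS; rewrite mem_nth.
  have := deg2 _ aS; rewrite /degree leqNgt => /negP[].
  (* The predecessor of [a], its successor and [b] are three distinct neighbours of [a]. *)
  rewrite -[3%N](_ : #|[set nth x0 s k.-1; nth x0 s k.+1; b]| = _).
    apply: subset_leq_card; apply/subsetP => y; rewrite !inE => /orP[/orP[]|] /eqP->.
    - by rewrite pS adj_sym.
    - by rewrite nS.
    - by rewrite bS.
  have bN l : (l < size s)%N -> nth x0 s l != b.
    by move=> ls; apply: contraNneq bs => <-; rewrite mem_nth.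
  have k1s : (k.-1 < size s)%N by apply: leq_ltn_trans (leq_pred k) (ltnW k1m).
  have k_k : (k.-1 == k.+1) = false by rewrite ltn_eqF // ltnS leq_pred.
  by rewrite -setUA cardsU1 cards2 !inE negb_or !bN // nth_uniq // k_k.
have s_all z : z \in S -> z \in s.
  move=> zS; have hs : nth x0 s 0 \in s by rewrite mem_nth ?sz.
  have /connectP[p ep ->] := conS _ _ (sS _ hs) zS.
  by elim: p (nth x0 s 0) hs ep => //= y p IHp x xs /andP[/(closed_s _ _ xs) ys /IHp]; apply.
have no_chord j k : (j < k)%N -> (k < m)%N -> G (nth x0 s j) (nth x0 s k) -> k = j.+1.
  move=> jk km jkG; apply/eqP; rewrite eqn_leq jk andbT leqNgt; apply/negP => jk1.
  (* The vertices at positions [j] to [k], at least three of them, would form a cycle closed by the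
     chord. *)
  pose q := take (k - j) (drop j.+1 s).
  have sq : size q = (k - j)%N by rewrite size_takel // size_drop sz; lia.
  have qE : nth x0 s j :: q = take (k - j).+1 (drop j s).
    by rewrite [in RHS](drop_nth x0) ?sz //; lia.
  have : ucycle e (nth x0 s j :: q).
    apply/andP; split; last by rewrite qE take_uniq // drop_uniq.
    have : sorted e (nth x0 s j :: q) by rewrite qE take_sorted // drop_sorted.
    rewrite /= rcons_path => ->; rewrite (last_nth x0) sq /=.
    have -> : nth x0 (nth x0 s j :: q) (k - j) = nth x0 s k.
      by rewrite qE nth_take // nth_drop; congr nth; lia.
    rewrite /induced /= adj_sym jkG andbT.
    by rewrite !sS // mem_nth ?sz //; lia.
  by move/acyc; rewrite /= sq; lia.
exists m, (fun j => nth x0 s j); split=> //.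
- by move=> j k /eqP; rewrite nth_uniq ?sz // => /eqP/val_inj.
- apply/setP => z; apply/idP/imsetP => [zS|[j _ ->]]; last by rewrite sS // mem_nth ?sz.
  have zs := s_all _ zS.
  have kz : (index z s < m)%N by rewrite -sz index_mem.
  by exists (Ordinal kz) => //=; rewrite nth_index.
have step j k : (j < m)%N -> (k < m)%N -> (j < k)%N ->
    G (nth x0 s j) (nth x0 s k) = (j.+1 == k).
  move=> jm km jk; apply/idP/eqP => [/no_chord-> //|kE].
  have /sortedP := s_sorted => /(_ x0 j); rewrite kE sz => /(_ km).
  by case/and3P.
move=> j k; case: (ltngtP j k) => [jk|kj|/val_inj->].
- by rewrite step // (_ : (k.+1 == j) = false) ?orbF //; apply/negP => /eqP; lia.
- by rewrite adj_sym step // (_ : (j.+1 == k) = false) //; apply/negP => /eqP; lia.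
- by rewrite adj_irr orbb; apply/esym/negP => /eqP; lia.
Qed.

End Trees.

(** * Obstruction for paths and generalized stars *)

Section Necessity.
Variables (R : realType) (n : nat) (G : sgraph n) (i : 'I_n) (A : 'M[R]_n).
Hypothesis AG : in_SG G A.
Local Notation S := [set~ i].
Implicit Types w x : 'I_n -> R.

Lemma entry_eq0 y z : y != z -> ~~ G y z -> A y z = 0.
Proof. by case: AG => _ pat yz; rewrite -pat // negbK => /eqP. Qed.

Lemma entry_neq0 y z : G y z -> A y z != 0.
Proof.
move=> yz; case: AG => _ ->//.
by apply: contraTneq yz => ->; rewrite adj_irr.
Qed.

Lemma ker_pin_vanish c : (1 < nullity (pin A i))%N ->
  exists w, [/\ in_ker (pin A i) w, exists z, w z != 0 & w c = 0].
Proof.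
move=> /(nullity_functional (fun z => (z == c)%:R))[w [kw wn0]].
rewrite (bigD1 c) //= eqxx mul1r big1 ?addr0 => [wc|z zc].
  by exists w.
by rewrite (negPf zc) mul0r.
Qed.

Lemma path_nullity_le1 : is_path G S -> (nullity (pin A i) <= 1)%N.
Proof.
case=> m [f [m_gt0 f_inj SE fG]]; rewrite leqNgt; apply/negP.
move/(ker_pin_vanish (f (Ordinal m_gt0))) => [w [/in_ker_pin[wi kw] [z0 wz0] w0]].
have fi k : f k != i.
  by have : f k \in S by [rewrite SE imset_f]; rewrite !inE.
(* The row at position [p] involves only the positions [p - 1], [p] and [p + 1], so vanishing up to
   [p] forces vanishing at [p + 1]. *)
have wf : forall p (pm : (p < m)%N), w (f (Ordinal pm)) = 0.
  elim/ltn_ind => -[|p] IH pm; first by rewrite (bool_irrelevance pm m_gt0).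
  have p'm : (p < m)%N by exact: ltnW.
  have := kw _ (fi (Ordinal p'm)); rewrite (bigD1 (f (Ordinal pm))) //= big1.
    rewrite addr0 => /eqP; rewrite mulf_eq0 (negPf (entry_neq0 _)) ?fG ?eqxx //=.
    by move/eqP.
  move=> z zp; have [->|zi] := eqVneq z i; first by rewrite wi mulr0.
  have : z \in S by rewrite !inE.
  rewrite SE => /imsetP[[k km] _ zE]; rewrite zE.
  have [kp|pk] := leqP k p; first by rewrite IH ?mulr0.
  have kp1 : k != p.+1.
    by apply: contraNneq zp => kE; rewrite zE; apply/eqP; congr f; exact: val_inj.
  rewrite entry_eq0 ?mul0r // ?(inj_eq f_inj) ?fG /= -?val_eqE /=; lia.
case/eqP: wz0; have [->//|zi] := eqVneq z0 i.
have : z0 \in S by rewrite !inE.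
by rewrite SE => /imsetP[[k km] _ ->].
Qed.

(** Away from [c] a vertex has at most two neighbours in [S], its predecessor and its successor on
    the leg; so its row carries zeros at itself and the predecessor on to the successor. *)
Lemma ker_pin_propagate c w p a q : (forall y, y \in S -> y != c -> (degree G S y <= 2)%N) ->
  in_ker (pin A i) w -> w p = 0 -> w a = 0 -> a != c -> induced G S p a ->
  path (induced G (S :\ c)) a q -> uniq [:: p, a & q] -> w (last a q) = 0.
Proof.
move=> deg2 /in_ker_pin[wi kw].
elim: q p a => //= b q IHq p a wp wa ac pa /andP[ab bq].
case/and3P=> pN aN uq.
have /and3P[pS aS Gpa] := pa.
move: (ab) => /and3P[]; rewrite !inE => /andP[_ _] /andP[bc bi] Gab.
have [pb ab'] : p != b /\ a != b.
  by move: pN aN; rewrite !inE !negb_or => /and3P[_ -> _] /andP[->].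
apply: (IHq a b) => //; last 2 first.
- by rewrite /induced /= aS Gab !inE bi.
- by rewrite /= aN.
have ai : a != i by move: aS; rewrite !inE.
have := kw _ ai; rewrite (bigD1 b) //= big1.
  by rewrite addr0 => /eqP; rewrite mulf_eq0 (negPf (entry_neq0 Gab)) => /eqP.
move=> z zb; have [->|zi] := eqVneq z i; first by rewrite wi mulr0.
have [->|zp] := eqVneq z p; first by rewrite wp mulr0.
have [->|za] := eqVneq z a; first by rewrite wa mulr0.
rewrite entry_eq0 ?mul0r // 1?eq_sym //; apply/negP => Gaz.
have := deg2 _ aS ac; rewrite /degree leqNgt => /negP[].
rewrite -[3%N](_ : #|[set p; b; z]| = _).
  apply: subset_leq_card; apply/subsetP => y; rewrite !inE => /orP[/orP[]|] /eqP->.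
  - by move: pS; rewrite !inE adj_sym => ->.
  - by rewrite bi.
  - by rewrite zi.
by rewrite -setUA cardsU1 cards2 !inE negb_or pb [p == z]eq_sym zp [b == z]eq_sym zb.
Qed.

(* A kernel vector [w] vanishing at [c] but not on the branch through [a], cut
   down to that branch, is mapped by [A] to a nonzero multiple of [e_c]. By
   symmetry of [A], every kernel vector vanishes at [c]. *)
Lemma star_ker_pin_center c x : connected G S -> acyclic G S -> c \in S ->
  (forall y, y \in S -> y != c -> (degree G S y <= 2)%N) ->
  (1 < nullity (pin A i))%N -> in_ker (pin A i) x -> x c = 0.
Proof.
move=> [_ conS] acyc cS deg2 null2 /in_ker_pin[xi kx].
have sepc := @acyclic_separates _ _ _ c acyc.
have [w [kerw [z0 wz0] wc]] := ker_pin_vanish c null2.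
have /in_ker_pin[wi kw] := kerw.
have z0c : z0 != c by apply: contraNneq wz0 => ->; rewrite wc.
have z0i : z0 != i by apply: contraNneq wz0 => ->; rewrite wi.
have cz0 : connect (induced G S) c z0 by apply: conS => //; rewrite !inE.
have [a [q [ca aq uq z0E]]] := first_step cz0 z0c.
have /and3P[_ aS Gca] := ca.
have ac : a != c by apply: contraTneq Gca => ->; rewrite adj_irr.
(* Otherwise the zeros at [c] and [a] would propagate along the leg to [z0]. *)
have wa : w a != 0.
  by apply: contraNneq wz0 => wa; rewrite z0E (@ker_pin_propagate c w c).
set e := induced G (S :\ c) in sepc aq.
have aSc : a \in S :\ c by rewrite in_setD1 ac.
pose w' y := if connect e a y then w y else 0.
have w'_out y : y \notin S :\ c -> w' y = 0.
  rewrite /w'; case ay: connect => //.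
  by rewrite (connect_induced_in aSc ay).
have w'i : w' i = 0 by rewrite w'_out // !inE eqxx andbF.
have w'c : w' c = 0 by rewrite w'_out // !inE eqxx.
have [symA _] := AG.
have := sym_pairing x w' symA.
rewrite big1 => [|y _]; last first.
  have [->|yi] := eqVneq y i; first by rewrite w'i mul0r.
  by rewrite kx // mulr0.
(* [A w'] vanishes at every [y] other than [c] and [i]: inside the branch the sum agrees with that
   of [w], since edges of [S] leave the branch only towards [c] and [w c = 0]; outside it no edge
   leads from [y] into the branch. *)
rewrite (bigD1 c) //= [X in _ + X]big1 => [|y yc]; last first.
  have [->|yi] := eqVneq y i; first by rewrite xi mul0r.
  apply/eqP; rewrite mulf_eq0; apply/orP; right; apply/eqP.
  case ay: (connect e a y).
    rewrite -[RHS](kw y yi); apply: eq_bigr => t _.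
    have [->|ti] := eqVneq t i; first by rewrite w'i wi.
    have [->|tc] := eqVneq t c; first by rewrite w'c wc.
    rewrite /w'; case at_: connect => //; rewrite mulr0.
    have [ty|ty] := eqVneq t y; first by rewrite ty ay in at_.
    rewrite entry_eq0 ?mul0r // 1?eq_sym //; apply/negP => Gyt.
    move: at_; rewrite (connect_trans ay (connect1 _)) //.
    by rewrite /e /induced /= !inE yc yi tc ti.
  apply: big1 => t _; rewrite /w'; case at_: connect; last by rewrite mulr0.
  have := connect_induced_in aSc at_; rewrite !inE => /andP[tc ti].
  have [ty|ty] := eqVneq t y; first by rewrite ty ay in at_.
  rewrite entry_eq0 ?mul0r // 1?eq_sym //; apply/negP => Gyt.
  move: ay; rewrite (connect_trans at_ (connect1 _)) //.
  by rewrite /e /induced /= !inE yc yi tc ti adj_sym.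
(* At [c] only [a] contributes, since [c] has no other neighbour in this branch. *)
rewrite addr0 (bigD1 a) //= big1 => [|t ta]; last first.
  have [->|ti] := eqVneq t i; first by rewrite w'i mulr0.
  have [->|tc] := eqVneq t c; first by rewrite w'c mulr0.
  rewrite /w'; case at_: connect; last by rewrite mulr0.
  rewrite entry_eq0 ?mul0r // 1?eq_sym //; apply/negP => Gct.
  have ct : induced G S c t by rewrite /induced /= cS Gct !inE ti.
  by have := sepc _ _ ca ct; rewrite at_ eq_sym => /(_ ta).
rewrite addr0 /w' connect0 => /esym/eqP.
by rewrite !mulf_eq0 (negPf (entry_neq0 Gca)) (negPf wa) !orbF => /eqP.
Qed.

(** If row [i] were orthogonal to the whole kernel of [pin A i], that kernel would lie in the kernel
    of [A]. *)
Lemma ker_pin_not_orthogonal : (nullity A < nullity (pin A i))%N ->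
  exists x, in_ker (pin A i) x /\ \sum_z A i z * x z != 0.
Proof.
move=> lt; apply: contrapT => none; move: lt; rewrite ltnNge => /negP[].
apply: nullity_sub => x kx y; have /in_ker_pin[xi ky] := kx.
have [->|yi] := eqVneq y i; last exact: ky.
by apply/eqP/negPn/negP => xn0; apply: none; exists x.
Qed.

End Necessity.

(** * Components of [G - i] and the equivalence *)

Lemma components_le1 n (G : sgraph n) (S : {set 'I_n}) x : x \in S ->
  (#|components G S| <= 1)%N -> connected G S /\ components G S = [set S].
Proof.
move=> xS le1.
pose comp y := [set z in S | connect (induced G S) y z].
have compS y : y \in S -> comp y \in components G S by move=> yS; apply: imset_f.
have same y z : y \in S -> z \in S -> comp y = comp z.
  move=> yS zS; have [<-//|ne] := eqVneq (comp y) (comp z).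
  suff : (1 < #|components G S|)%N by rewrite ltnNge le1.
  by apply/card_gt1P; exists (comp y), (comp z); split; rewrite ?compS.
have conS : {in S &, forall y z, connect (induced G S) y z}.
  move=> y z yS zS; have : z \in comp z by rewrite inE zS connect0.
  by rewrite -(same y) // inE => /andP[].
have compE y : y \in S -> comp y = S.
  by move=> yS; apply/setP => z; rewrite inE; case zS: (z \in S); rewrite //= conS.
split; first by split=> //; apply/set0Pn; exists x.
apply/setP => C; rewrite inE; apply/imsetP/eqP => [[y yS ->]|->]; first exact: compE.
by exists x => //; rewrite -/(comp x) compE.
Qed.

Lemma root_has_nbr n (G : sgraph n) (i x : 'I_n) : connected G setT -> x != i ->
  exists j, G i j.
Proof.
move=> [_ con] xi.
have [a [q [/and3P[_ _ ia] _ _ _]]] := first_step (con i x (in_setT _) (in_setT _)) xi.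
by exists a.
Qed.

Lemma components_gt1 n (G : sgraph n) (S : {set 'I_n}) j : j \in S ->
  (1 < #|components G S|)%N -> exists2 a, a \in S & ~~ connect (induced G S) j a.
Proof.
move=> jS /card_gt1P[_ [_ [/imsetP[y yS ->] /imsetP[z zS ->] ne]]].
apply: contrapT => none; case/eqP: ne; apply/setP => t; rewrite !inE.
have conj a : a \in S -> connect (induced G S) j a.
  by move=> aS; apply/negPn/negP => ja; apply: none; exists a.
case tS: (t \in S) => //=.
have conn a : a \in S -> connect (induced G S) a t.
  by move=> aS; apply: connect_trans (conj _ tS); rewrite connect_induced_sym conj.
by rewrite !conn.
Qed.

Theorem theorem5p11 (R : realType) (n : nat) (G : sgraph n) (i : 'I_n)
    (conG : connected G [set: 'I_n]) :
  allows_nullity_pair R G i 1 2 <->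
  ~ (is_yam G i /\ (#|components G [set~ i]| <= 1)%N).
Proof.
split.
  case=> A [AG [nullA]]; rewrite nullity_del_rc => nullAi [[_ yam] le1].
  have null2 : (1 < nullity (pin A i))%N by rewrite nullAi.
  have [w [/in_ker_pin[wi _] [x wx] _]] := ker_pin_vanish i null2.
  (* A nonzero kernel vector vanishing at [i] shows that [G - i] has a vertex. *)
  have xS : x \in [set~ i] by rewrite !inE; apply: contraNneq wx => ->; rewrite wi.
  have [conS compE] := components_le1 xS le1.
  have [|star_or_path star_nbrs] := yam [set~ i]; first by rewrite compE set11.
  case: star_or_path => [star|pth]; last by have := path_nullity_le1 AG pth; rewrite nullAi.
  have [[_ acyc] [c [[cS c3] c_uniq]]] := star.
  have deg2 y : y \in [set~ i] -> y != c -> (degree G [set~ i] y <= 2)%N.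
    by move=> yS yc; rewrite leqNgt; apply/negP => y3; case/eqP: yc; rewrite (c_uniq y).
  have [|z [kz]] := @ker_pin_not_orthogonal _ _ i A; first by rewrite nullA nullAi.
  have zc := star_ker_pin_center AG conS acyc cS deg2 null2 kz.
  have /in_ker_pin[zi _] := kz.
  (* In [G - i], row [i] can be nonzero only at the center [c], where [z] vanishes; so it is
     orthogonal to [z]. *)
  case/eqP; apply: big1 => k _.
  have [->|ki] := eqVneq k i; first by rewrite zi mulr0.
  have [->|kc] := eqVneq k c; first by rewrite zc mulr0.
  rewrite (entry_eq0 AG) ?mul0r // 1?eq_sym //; apply/negP => Gik.
  have kS : k \in [set~ i] by rewrite !inE.
  have [_ high_k] := (star_nbrs star k kS).1 Gik.
  by case/eqP: kc; rewrite (c_uniq k).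
move=> nyam.
have [[x xi]|alone] := pselect (exists x, x != i); last first.
  (* With no vertex besides [i] there are no components, and the yam condition holds vacuously. *)
  case: nyam; have S0 : [set~ i] = set0.
    apply/setP => x; rewrite !inE; apply/negbTE/negP => xi; apply: alone; exists x; exact: xi.
  have comp0 : components G [set~ i] = set0 by rewrite S0 /components imset0.
  by rewrite comp0 cards0; split=> //; split=> // C; rewrite comp0 inE.
have xS : x \in [set~ i] by rewrite !inE.
have [j0 Gij0] := root_has_nbr conG xi.
have [le1|gt1] := leqP #|components G [set~ i]| 1; last first.
  have [a aS ja] := components_gt1 (root_nbr Gij0) gt1.
  exact (allows_disconnected R Gij0 aS ja).
have [conS compE] := components_le1 xS le1.
have [acyc|cyc] := pselect (acyclic G [set~ i]); last first.
  have [u [v [uv uv']]] := not_acyclic_nonbridge cyc.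
  exact (allows_nonbridge R Gij0 conS uv uv').
(* If every neighbour of [i] equalled every vertex of high degree, [G - i] would be a path or a
   generalized star attached only at its center, and [(G, i)] would be a yam graph. *)
have [j [c [Gij hc jc]]] : exists j c, [/\ G i j, high_degree G [set~ i] c & j != c].
  apply: contrapT => none; apply: nyam; split=> //; split=> // C.
  rewrite compE => /set1P->.
  have [[c hc]|low] := pselect (exists c, high_degree G [set~ i] c); last first.
    split=> [|[_ [c [hc _]]]]; last by case: low; exists c.
    right; apply: acyclic_deg2_is_path => // y yS; rewrite leqNgt; apply/negP => y3.
    by apply: low; exists y.
  have nbr_high j' c' : G i j' -> high_degree G [set~ i] c' -> j' = c'.
    move=> Gij' hc'; apply/eqP/negPn/negP => jc; apply: none.
    by exists j', c'.
  have star : is_generalized_star G [set~ i].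
    split=> //; exists c; split=> // c' hc'.
    by rewrite -(nbr_high _ _ Gij0 hc) (nbr_high _ _ Gij0 hc').
  split; first by left.
  move=> _ y yS; split=> [Giy|[_ hy]]; last by rewrite -(nbr_high _ _ Gij0 hy).
  by split=> //; rewrite (nbr_high _ _ Giy hc).
exact (allows_branching R Gij conS hc (acyclic_separates acyc) jc).
Qed.
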